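(* Let $a,b$ be non-zero real numbers and let $(J_n)_{n\ge 0}$ be the bi-periodic Jacobsthal matrix sequence associated with $a,b$. Then its generating function (as a power series in $x$ with matrix coefficients) is $$\sum_{m=0}^{\infty}J_m x^m=\frac{J_0+J_1x+\left[aJ_1-(ab+2)J_0\right]x^2+\left[2bJ_0-2J_1\right]x^3}{1-(ab+4)x^2+4x^4},$$ which is expressed in component form as $$\sum_{m=0}^{\infty}J_m x^m=\frac{1}{1-(ab+4)x^2+4x^4}\begin{pmatrix} 1+bx-2x^2 & 2\frac{b}{a}x+2bx^2-4\frac{b}{a}x^3\\[2pt] x+ax^2-2x^3 & 1-(ab+2)x^2+2bx^3\end{pmatrix}.$$
   Context: Fix non-zero real numbers $a,b$. The bi-periodic Jacobsthal matrix sequence $(J_n)_{n\ge 0}$ of $2\times 2$ real matrices is defined by $J_0=\begin{pmatrix}1&0\\0&1\end{pmatrix}$, $J_1=\begin{pmatrix} b & 2\frac{b}{a}\\ 1&0\end{pmatrix}$, and for $n\ge 2$: $J_n=aJ_{n-1}+2J_{n-2}$ if $n$ is even, $J_n=bJ_{n-1}+2J_{n-2}$ if $n$ is odd. The identities are between formal power series in $x$ with coefficients in the $2\times2$ real matrices; division by the scalar polynomial $1-(ab+4)x^2+4x^4$ (constant term $1$) means multiplication by its inverse formal power series. *)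

(* Defs.v *)
From HB Require Import structures.
From mathcomp Require Import all_boot all_order all_algebra.
From mathcomp Require Import boolp reals.

Set Implicit Arguments.
Unset Strict Implicit.
Unset Printing Implicit Defensive.

Import Order.TTheory GRing.Theory Num.Theory.
Local Open Scope ring_scope.

(* A formal power series \sum_m (f m) x^m is its sequence of coefficients. *)
Definition fps (A : Type) : Type := nat -> A.

Definition fps_gen (A : Type) (c : nat -> A) : fps A := c.

Definition fps_poly (A : nzRingType) (p : {poly A}) : fps A := fun n => p`_n.

Definition fps_mul (A : nzRingType) (u v : fps A) : fps A :=
  fun n => \sum_(i < n.+1) u i * v (n - i)%N.

(* Cauchy product of a scalar series with a module-valued series. *)
Definition fps_scale (A : nzRingType) (V : lmodType A) (u : fps A) (f : fps V) :
    fps V :=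
  fun n => \sum_(i < n.+1) u i *: f (n - i)%N.

(* [fps_inv_seq u n] lists the first n coefficients v_0, ..., v_(n-1) of the
   inverse v of u, obtained by solving \sum_(i <= k) u_(k-i) v_i = [k = 0]
   for v_k.  It is meaningful only when u 0 is invertible. *)
Fixpoint fps_inv_seq (A : unitRingType) (u : fps A) (n : nat) : seq A :=
  if n is k.+1 then
    let s := fps_inv_seq u k in
    rcons s ((u 0%N)^-1 * ((k == 0%N)%:R - \sum_(i < k) u (k - i)%N * s`_i))
  else [::].

Definition fps_inv (A : unitRingType) (u : fps A) : fps A :=
  fun n => (fps_inv_seq u n.+1)`_n.

Definition fps_div (A : unitRingType) (V : lmodType A) (f : fps V) (u : fps A) :
    fps V :=
  fps_scale (fps_inv u) f.

(* A matrix of polynomials, read as a series with matrix coefficients. *)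
Definition fps_mxpoly (A : nzRingType) (m n : nat) (M : 'M[{poly A}]_(m, n)) :
    fps 'M[A]_(m, n) :=
  fun k => \matrix_(i, j) (M i j)`_k.

Definition mx2 (T : Type) (x00 x01 x10 x11 : T) : 'M[T]_2 :=
  \matrix_(i < 2, j < 2)
    if i == 0 then (if j == 0 then x00 else x01)
    else (if j == 0 then x10 else x11).

Fixpoint jacobsthal_mx (R : realType) (a b : R) (n : nat) : 'M[R]_2 :=
  match n with
  | 0 => mx2 1 0 0 1
  | 1 => mx2 b (2 * (b / a)) 1 0
  | (k.+1 as m).+1 =>
      (if odd n then b else a) *: jacobsthal_mx a b m
      + 2 *: jacobsthal_mx a b k
  end.

Lemma size_fps_inv_seq (A : unitRingType) (u : fps A) (n : nat) :
  size (fps_inv_seq u n) = n.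
Proof. by elim: n => //= n IHn; rewrite size_rcons IHn. Qed.

Lemma nth_fps_inv_seq (A : unitRingType) (u : fps A) (n i : nat) :
  (i < n)%N -> (fps_inv_seq u n)`_i = fps_inv u i.
Proof.
elim: n => // n IHn; rewrite ltnS leq_eqVlt => /orP[/eqP -> //|ltin].
by rewrite /= nth_rcons size_fps_inv_seq ltin IHn.
Qed.

Lemma fps_invE (A : unitRingType) (u : fps A) (n : nat) :
  fps_inv u n =
    (u 0%N)^-1 * ((n == 0%N)%:R - \sum_(i < n) u (n - i)%N * fps_inv u i).
Proof.
rewrite {1}/fps_inv /= nth_rcons size_fps_inv_seq ltnn eqxx.
by congr (_ * (_ - _)); apply: eq_bigr => i _; rewrite nth_fps_inv_seq.
Qed.

Lemma fps_mulrV (A : unitRingType) (u : fps A) :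
  u 0%N \is a GRing.unit -> fps_mul u (fps_inv u) = fps_poly 1.
Proof.
move=> u0; apply/funext => n; rewrite /fps_mul /fps_poly coef1.
rewrite (reindex_inj rev_ord_inj) /= big_ord_recr /= subnn subn0.
rewrite [X in _ + _ * X]fps_invE mulVKr //.
under eq_bigr => i _ do
  rewrite subSS subKn ?(ltnW (ltn_ord i)) //.
by rewrite addrC subrK.
Qed.

(* Main.v *)
(** Eliminating the terms at odd distance from the bi-periodic recurrence gives
    [J_(n+4) = (ab + 4) J_(n+2) - 4 J_n] whatever the parity of [n], so the
    product of the series by the denominator is a polynomial of degree at
    most 3; the denominator can then be divided out, its constant term being 1. *)

Require Import Defs.
From HB Require Import structures.
From mathcomp Require Import all_boot all_order all_algebra.
From mathcomp Require Import boolp reals.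
From mathcomp Require Import ring.

Set Implicit Arguments.
Unset Strict Implicit.
Unset Printing Implicit Defensive.

Import Order.TTheory GRing.Theory Num.Theory.
Local Open Scope ring_scope.

(** Both sides run over the pairs with [i + j <= n], grouped by [k = i + j] on the left and by [i]
    on the right. *)
Lemma exchange_triangular_sum (V : nmodType) (n : nat) (F : nat -> nat -> V) :
  \sum_(k < n.+1) \sum_(i < k.+1) F i (k - i)%N =
  \sum_(i < n.+1) \sum_(j < (n - i).+1) F i j.
Proof.
transitivity (\sum_(k < n.+1) \sum_(i < n.+1 | (i <= k)%N) F i (k - i)%N).
  by apply: eq_bigr => k _; rewrite (big_ord_widen n.+1 (fun i => F i (k - i)%N) (ltn_ord k)).
rewrite (exchange_big_dep xpredT) //=; apply: eq_bigr => i _.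
(* On intervals of naturals the filter [i <= k] becomes the lower bound, and the shift [j = k - i]
   applies. *)
rewrite -subSn -1?ltnS // -(big_mkord xpredT (F i)).
rewrite -(big_mkord (fun k => i <= k)%N (fun k => F i (k - i)%N)).
rewrite -(@big_nat_widenl _ _ _ i 0 n.+1 xpredT) // -{1}[i : nat]add0n big_addn.
by apply: eq_bigr => j _; rewrite addnK.
Qed.

Lemma fps_scaleA (A : nzRingType) (V : lmodType A) (u v : fps A) (f : fps V) :
  fps_scale u (fps_scale v f) = fps_scale (fps_mul u v) f.
Proof.
apply/funext => n; rewrite /fps_scale /fps_mul.
under eq_bigr do rewrite scaler_sumr.
rewrite -(exchange_triangular_sum n
  (fun i j => u i *: (v j *: f (n - i - j)%N))).
apply: eq_bigr => k _; rewrite scaler_suml; apply: eq_bigr => i _.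
by rewrite scalerA -subnDA subnKC // -ltnS.
Qed.

Lemma fps_mulC (A : comNzRingType) (u v : fps A) : fps_mul u v = fps_mul v u.
Proof.
apply/funext => n; rewrite /fps_mul (reindex_inj rev_ord_inj) /=.
by apply: eq_bigr => i _; rewrite mulrC subSS subKn // -ltnS.
Qed.

Lemma fps_scale1 (A : nzRingType) (V : lmodType A) (f : fps V) :
  fps_scale (fps_poly 1) f = f.
Proof.
apply/funext => n; rewrite /fps_scale big_ord_recl /fps_poly coef1 scale1r subn0.
by rewrite big1 ?addr0 // => i _; rewrite coef1 scale0r.
Qed.

(** [fps_mulrV] gives a right inverse while [fps_div] multiplies by the inverse on the left, hence
    the appeal to commutativity. *)
Lemma fps_scaleK (A : comUnitRingType) (V : lmodType A) (u : fps A)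
    (f : fps V) :
  u 0%N \is a GRing.unit -> fps_div (fps_scale u f) u = f.
Proof.
by move=> u0; rewrite /fps_div fps_scaleA fps_mulC fps_mulrV ?fps_scale1.
Qed.

Lemma jacobsthal_mxSS (R : realType) (a b : R) (n : nat) :
  jacobsthal_mx a b n.+2 =
    (if odd n then b else a) *: jacobsthal_mx a b n.+1
    + 2 *: jacobsthal_mx a b n.
Proof. by rewrite /= negbK. Qed.

Local Arguments jacobsthal_mx : simpl never.

(** Consecutive steps use [a] and [b] in some order, with product [a * b]. The steps to [n.+2] and
    [n.+4] share one coefficient [c], so the leftover [2 c J_(n+1)] equals [2 J_(n+2) - 4 J_n]. *)
Lemma jacobsthal_mx_rec4 (R : realType) (a b : R) (n : nat) :
  jacobsthal_mx a b n.+4 =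
    (a * b + 4) *: jacobsthal_mx a b n.+2 - 4 *: jacobsthal_mx a b n.
Proof.
rewrite (jacobsthal_mxSS _ _ n.+2) (jacobsthal_mxSS _ _ n.+1).
rewrite (jacobsthal_mxSS _ _ n) !oddS negbK.
by apply/matrixP => i j; rewrite !mxE; case: (odd n) => /=; ring.
Qed.

Definition jacobsthal_den (R : realType) (a b : R) : {poly R} :=
  1 - (a * b + 4) *: 'X^2 + 4 *: 'X^4.

Definition jacobsthal_num (R : realType) (a b : R) : {poly 'M[R]_2} :=
  let J := jacobsthal_mx a b in
  (J 0%N)%:P + J 1%N *: 'X
  + (a *: J 1%N - (a * b + 2) *: J 0%N) *: 'X^2
  + ((2 * b) *: J 0%N - 2 *: J 1%N) *: 'X^3.

Lemma fps_scale_jacobsthal_den (R : realType) (a b : R) :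
  fps_scale (fps_poly (jacobsthal_den a b)) (fps_gen (jacobsthal_mx a b)) =
  fps_poly (jacobsthal_num a b).
Proof.
apply/funext; rewrite /fps_scale /fps_poly /fps_gen.
case=> [|[|[|[|n]]]]; last first.
(* Degree [n.+4]: the denominator has degree at most 4, so only the first five terms can survive,
   and the four-step recurrence cancels them. *)
- rewrite 5!big_ord_recl big1 => [|i _]; last first.
    rewrite !(coefB, coefD, coefZ, coef1, coefXn) /= !mulr0.
    by rewrite subrr addr0 scale0r.
  rewrite !(coefB, coefD, coefZ, coef1, coefXn, coefX, coefC) /=.
  rewrite /bump /= !subSS !subn0 !mulr0 jacobsthal_mx_rec4.
  by apply/matrixP => i j; rewrite !mxE; ring.
(* Degrees 0 to 3: the recurrence is unfolded down to [J_0] and [J_1], which yields the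
   numerator. *)
all: rewrite ?big_ord_recl big_ord0 /bump /= ?subSS ?subn0 ?jacobsthal_mxSS.
all: rewrite !(coefB, coefD, coefZ, coef1, coefXn, coefX, coefC) /=.
(* Matrix products by 0 or 1 are removed before [mxE] could expand them into sums. *)
all: rewrite ?mulr0 ?mulr1.
all: by apply/matrixP => i j; rewrite !mxE; ring.
Qed.

Theorem theorem7 (R : realType) (a b : R) (ha : a != 0) (hb : b != 0) :
  let J := jacobsthal_mx a b in
  let D : {poly R} := 1 - (a * b + 4) *: 'X^2 + 4 *: 'X^4 in
  fps_gen J =
    fps_div
      (fps_poly ((J 0%N)%:P + J 1%N *: 'X
                 + (a *: J 1%N - (a * b + 2) *: J 0%N) *: 'X^2
                 + ((2 * b) *: J 0%N - 2 *: J 1%N) *: 'X^3))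
      (fps_poly D)
  /\
  fps_gen J =
    fps_div
      (fps_mxpoly
         (mx2 (1 + b *: 'X - 2 *: 'X^2)
              ((2 * (b / a)) *: 'X + (2 * b) *: 'X^2 - (4 * (b / a)) *: 'X^3)
              ('X + a *: 'X^2 - 2 *: 'X^3)
              (1 - (a * b + 2) *: 'X^2 + (2 * b) *: 'X^3)))
      (fps_poly D).
Proof.
move=> J D.
have D0 : fps_poly D 0 \is a GRing.unit.
  rewrite /fps_poly !(coefB, coefD, coefZ, coef1, coefXn) !mulr0.
  by rewrite subr0 addr0 unitr1.
have JE : fps_gen J = fps_div (fps_poly (jacobsthal_num a b)) (fps_poly D).
  by rewrite -fps_scale_jacobsthal_den fps_scaleK.
split; first exact: JE.
(* The denominators agree, so it is enough to compare the numerators entry by entry in each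
   degree. *)
rewrite JE; congr fps_div; apply/funext => n; rewrite /fps_poly /fps_mxpoly.
apply/matrixP => i j; rewrite /jacobsthal_num /= !mxE.
rewrite !(coefB, coefD, coefZ, coef1, coefXn, coefX, coefC).
case: n => [|[|[|[|n]]]] /=; rewrite ?mulr0 ?mulr1.
all: rewrite !mxE; case: ifP => _; case: ifP => _.
all: rewrite !(coefB, coefD, coefZ, coef1, coefXn, coefX, coefC) /=.
(* Here [ha] matters: the upper right entry in degree 2 needs [a * (2 * (b / a)) = 2 * b]. *)
all: by field.
Qed.
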